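(* For every integer $q\geq 2$, $C(2,q)=\lfloor q/2\rfloor\,\lceil q/2\rceil$. In particular, \[ \lim_{q\rightarrow\infty}\frac{C(2,q)}{q^2/2}=\frac12. \]
   Context: Let $F$ be a finite alphabet with $|F|=q$. Two words $u,v\in F^n$ (not necessarily distinct) are overlapping if a non-empty proper prefix of $u$ equals a non-empty proper suffix of $v$, or a non-empty proper prefix of $v$ equals a non-empty proper suffix of $u$. A code $C\subseteq F^n$ is non-overlapping if for all (not necessarily distinct) $u,v\in C$, the words $u$ and $v$ are not overlapping. $C(n,q)$ denotes the maximum cardinality of a non-overlapping code $C\subseteq F^n$ with $|F|=q$. *)

(* Defs.v *)
From mathcomp Require Import all_boot all_order all_algebra.
From mathcomp Require Import all_classical all_reals all_analysis.

Set Implicit Arguments.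
Unset Strict Implicit.
Unset Printing Implicit Defensive.

Definition nonempty_proper_prefix (F : eqType) (p u : seq F) : bool :=
  [&& p != [::], p != u & prefix p u].

Definition nonempty_proper_suffix (F : eqType) (s u : seq F) : bool :=
  [&& s != [::], s != u & suffix s u].

Definition overlapping (F : eqType) (u v : seq F) : Prop :=
  (exists w, nonempty_proper_prefix w u /\ nonempty_proper_suffix w v) \/
  (exists w, nonempty_proper_prefix w v /\ nonempty_proper_suffix w u).

(* The case u = v is included: no word of C overlaps itself. *)
Definition non_overlapping (F : finType) (n : nat) (C : {set n.-tuple F}) : Prop :=
  forall u v : n.-tuple F, u \in C -> v \in C -> ~ overlapping u v.

Definition max_non_overlapping (n : nat) (F : finType) : nat :=
  (\max_(C : {set n.-tuple F} | `[< non_overlapping C >]) #|C|)%N.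

(* C(n, q), computed on the alphabet 'I_q; by max_non_overlapping_card below,
   any other alphabet with q letters gives the same value. *)
Definition C_max (n q : nat) : nat := max_non_overlapping n 'I_q.

Lemma prefix_suffix_map (F G : eqType) (f : F -> G) (u v : seq F) (w : seq G) :
  injective f ->
  nonempty_proper_prefix w (map f u) -> nonempty_proper_suffix w (map f v) ->
  exists w', nonempty_proper_prefix w' u /\ nonempty_proper_suffix w' v.
Proof.
move=> f_inj /and3P[w0 wu /prefixP[s us]] /and3P[_ wv wsv].
have ew : w = map f (take (size w) u).
  by rewrite map_take us take_size_cat.
move: w0 wu wsv wv; rewrite ew; set w' := take _ u => w0 wu wsv wv.
have w'0 : w' != [::] by apply: contraNneq w0 => ->.
exists w'; split; apply/and3P; split=> //.
- by apply: contraNneq wu => ->.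
- by rewrite /w' -{2}(cat_take_drop (size w) u) prefix_prefix.
- by apply: contraNneq wv => ->.
- move: wsv => /suffixP[t vt]; apply/suffixP; exists (take (size t) v).
  apply: (inj_map f_inj); rewrite map_cat map_take vt.
  by rewrite take_size_cat.
Qed.

Lemma max_non_overlapping_inj (F G : finType) (f : F -> G) (n : nat) :
  injective f -> (max_non_overlapping n F <= max_non_overlapping n G)%N.
Proof.
move=> f_inj; apply/bigmax_leqP => C /asboolP noC.
have tf_inj : injective (@map_tuple n F G f).
  by move=> u v /(congr1 val) /(inj_map f_inj) /val_inj.
rewrite -(card_imset (mem C) tf_inj) /max_non_overlapping.
apply: (bigmax_sup (@map_tuple n F G f @: C)%SET) => //.
apply/asboolP => _ _ /imsetP[u uC ->] /imsetP[v vC ->] /= ov.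
apply: (noC u v uC vC); case: ov => [[w [pw sw]]|[w [pw sw]]].
- by left; exact: prefix_suffix_map f_inj pw sw.
- by right; exact: prefix_suffix_map f_inj pw sw.
Qed.

Lemma max_non_overlapping_card (n : nat) (F : finType) :
  max_non_overlapping n F = C_max n #|F|.
Proof.
apply/eqP; rewrite eqn_leq; apply/andP; split.
- exact: max_non_overlapping_inj n (@enum_rank_inj F).
- exact: max_non_overlapping_inj n (@enum_val_inj F predT).
Qed.

(* Main.v *)
Require Import Defs.
From mathcomp Require Import all_boot all_order all_algebra.
From mathcomp Require Import all_classical all_reals all_analysis.
From mathcomp Require Import zify ring lra.
Import Order.TTheory GRing.Theory Num.Theory.
Import numFieldNormedType.Exports.
Local Open Scope classical_set_scope.
Local Open Scope ring_scope.

(** Two words [ab] and [cd] of length two overlap exactly when [a = d] or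
    [c = b].  Hence a code of length-two words is non-overlapping iff the set
    [A] of its first letters is disjoint from the set [B] of its second
    letters, and it then has at most [#|A| * #|B|] words, where
    [#|A| + #|B| <= q]; all of [A * ~: A] with [#|A| = q./2] is optimal.
    The limit follows from [4 * (q./2 * uphalf q) + odd q = q ^ 2]. *)

Lemma nonempty_proper_prefix2 (F : eqType) (w : seq F) (a b : F) :
  nonempty_proper_prefix w [:: a; b] = (w == [:: a]).
Proof.
rewrite /nonempty_proper_prefix.
case: w => [|x [|y [|z w]]] //=; rewrite !eqseq_cons ?andbT ?andbF //.
by case: (x == a); case: (y == b).
Qed.

(** Reversing words turns suffixes into prefixes, which reduces this to the prefix case. *)
Lemma nonempty_proper_suffix2 (F : eqType) (w : seq F) (c d : F) :
  nonempty_proper_suffix w [:: c; d] = (w == [:: d]).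
Proof.
have -> : nonempty_proper_suffix w [:: c; d]
        = nonempty_proper_prefix (rev w) [:: d; c].
  rewrite /nonempty_proper_suffix /nonempty_proper_prefix /suffix.
  by rewrite -[[:: d; c]]/(rev [:: c; d]) !(inj_eq (can_inj revK))
             -[[::]]/(rev [::] : seq F) (inj_eq (can_inj revK)).
by rewrite nonempty_proper_prefix2 -[[:: d]]/(rev [:: d]) (inj_eq (can_inj revK)).
Qed.

Lemma overlapping2 (F : eqType) (a b c d : F) :
  overlapping [:: a; b] [:: c; d] <-> a = d \/ c = b.
Proof.
split.
  by case=> -[w []]; rewrite nonempty_proper_prefix2 nonempty_proper_suffix2;
    move=> /eqP -> /eqP[]; [left | right].
by case=> ->; [left; exists [:: d] | right; exists [:: b]];
  rewrite nonempty_proper_prefix2 nonempty_proper_suffix2.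
Qed.

(** By symmetry [a <= h] with [h = q./2], and [b] may be raised to [q - a]. Then [h * (q - h) - a *
    (q - a) = (h - a) * (q - h - a)], where both factors are nonnegative. *)
Lemma leq_mul_half (a b q : nat) : (a + b <= q -> a * b <= q./2 * uphalf q)%N.
Proof.
wlog ah : a b / (a <= q./2)%N => [wlg abq|abq].
  case: (leqP a q./2) => ah; first exact: wlg.
  by rewrite mulnC; apply: wlg; lia.
have bq : (b <= q - a)%N by lia.
apply: leq_trans (leq_mul (leqnn a) bq) _.
rewrite (_ : uphalf q = q - q./2)%N; last by lia.
have : (q./2 + q./2 <= q)%N by lia.
by move: (q./2) ah => h ah hq; nia.
Qed.

Lemma non_overlapping2_card_le (F : finType) (C : {set 2.-tuple F}) :
  non_overlapping C -> (#|C| <= #|F|./2 * uphalf #|F|)%N.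
Proof.
move=> noC.
pose fst2 (u : 2.-tuple F) := tnth u ord0.
pose snd2 (u : 2.-tuple F) := tnth u ord_max.
have uE (u : 2.-tuple F) : u = [:: fst2 u; snd2 u] :> seq F.
  by case/tupleP: u => a u; case/tupleP: u => b u; rewrite (tuple0 u).
pose A := (fst2 @: C)%SET; pose B := (snd2 @: C)%SET.
have AB0 : (A :&: B)%SET = finset.set0.
  apply/setP => x; rewrite !inE; apply/negP => /andP[/imsetP[u uC xu] /imsetP[v vC xv]].
  apply: (noC u v uC vC); rewrite (uE u) (uE v); apply/overlapping2; left.
  by rewrite -xu.
apply: leq_trans (leq_mul_half #|A| #|B| _ _); last first.
  by have := max_card (mem (A :|: B)%SET); rewrite cardsU AB0 cards0 subn0.
(* A word is determined by its two letters, so [g] embeds [C] into the product of [A] and [B]. *)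
rewrite -cardsX; pose g u := (fst2 u, snd2 u).
have g_inj : injective g.
  by move=> u v [e1 e2]; apply: val_inj; rewrite /= (uE u) (uE v) e1 e2.
rewrite -(card_imset (mem C) g_inj); apply/subset_leq_card/fintype.subsetP => _ /imsetP[u uC ->].
by rewrite inE /= !imset_f.
Qed.

Lemma non_overlapping2_card_ge (F : finType) :
  exists2 C : {set 2.-tuple F}, non_overlapping C & #|C| = (#|F|./2 * uphalf #|F|)%N.
Proof.
have [A Ah] : exists A : {set F}, #|A| = #|F|./2.
  (* Any subset of this size would do; take the first letters in the enumeration of [F]. *)
  exists [set x in take #|F|./2 (enum F)]%SET; rewrite cardsE.
  move/card_uniqP: (take_uniq #|F|./2 (enum_uniq F)) => ->.
  by rewrite size_takel // -cardE -divn2; exact: leq_div.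
pose f (x : F * F) := [tuple x.1; x.2].
exists (f @: finset.setX A (~: A))%SET.
  move=> _ _ /imsetP[[a b] + ->] /imsetP[[c d] + ->].
  rewrite !inE /= => /andP[aA bA] /andP[cA dA] /overlapping2[ad|cb].
    by rewrite -ad aA in dA.
  by rewrite -cb cA in bA.
have f_inj : injective f by move=> [a b] [c d] [-> ->].
have := cardsC A; rewrite card_imset // cardsX Ah => AC.
by congr muln; lia.
Qed.

Lemma C_max2 (q : nat) : C_max 2 q = (q./2 * uphalf q)%N.
Proof.
apply/eqP; rewrite eqn_leq; apply/andP; split.
  apply/bigmax_leqP => C /asboolP /non_overlapping2_card_le.
  by rewrite card_ord.
have [C noC] := non_overlapping2_card_ge 'I_q; rewrite card_ord => <-.
by apply: (bigop.bigmax_sup C) => //; apply/asboolP.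
Qed.

(** Writing [q] as [odd q + 2 * q./2] shows that [q / 2] exceeds [q./2] by 0 or 1/2, according to
    parity. *)
Lemma floor_half (R : realType) (q : nat) : Num.floor (q%:R / 2 : R) = q./2%:Z.
Proof.
apply: floor_def; rewrite -[in q%:R](odd_double_half q) -muln2 natrD natrM.
rewrite intrD -!pmulrn.
by case: (odd q) => /=; lra.
Qed.

Lemma ceil_half (R : realType) (q : nat) : Num.ceil (q%:R / 2 : R) = (uphalf q)%:Z.
Proof.
apply: ceil_def; rewrite uphalf_half -[in q%:R](odd_double_half q) -muln2 natrD natrM.
rewrite intrB -!pmulrn natrD.
by case: (odd q) => /=; lra.
Qed.

(** With [q = 2h + r] and [r] the parity bit, this is [4h(h + r) + r = (2h + r)^2], true because
    [r^2 = r]. *)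
Lemma sqr_half_uphalf (q : nat) : (4 * (q./2 * uphalf q) + odd q = q ^ 2)%N.
Proof.
rewrite uphalf_half -[in RHS](odd_double_half q) -muln2.
by case: (odd q) => /=; nia.
Qed.

Theorem theorem6 (R : realType) :
  (forall q : nat, (2 <= q)%N ->
     (C_max 2 q)%:Z = Num.floor (q%:R / 2 : R) * Num.ceil (q%:R / 2 : R)) /\
  ((C_max 2 q)%:R / ((q%:R) ^+ 2 / 2) : R) @[q --> \oo] --> (1 / 2 : R).
Proof.
split=> [q _|]; first by rewrite C_max2 floor_half ceil_half PoszM.
have dist_le (q : nat) :
  `|(C_max 2 q)%:R / ((q%:R) ^+ 2 / 2) - 1 / 2 : R| <= harmonic q.
  have := congr1 (fun n => n%:R : R) (sqr_half_uphalf q).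
  rewrite /= -C_max2 natrD natrM natrX; set c := (C_max 2 q)%:R => cE.
  (* At [q = 0] the quotient is 0 by the convention for division by zero, so the distance is 1/2,
     below [harmonic 0 = 1]. *)
  case: (posnP q) => [->|q0].
    by rewrite expr0n /= mul0r invr0 mulr0 sub0r normrN ger0_norm; lra.
  have q1 : 1 <= q%:R :> R by rewrite ler1n.
  have qn0 : q%:R != 0 :> R by rewrite pnatr_eq0 -lt0n.
  (* The exact error: zero for even [q], and of order [1 / q^2] for odd [q]. *)
  have -> : c / (q%:R ^+ 2 / 2) - 1 / 2 = - ((odd q)%:R / (2 * q%:R ^+ 2)) :> R.
    have -> : c = (q%:R ^+ 2 - (odd q)%:R) / 4 by lra.
    by field.
  rewrite normrN ger0_norm ?divr_ge0 ?mulr_ge0 ?exprn_ge0 //.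
  rewrite ler_pdivrMr ?mulr_gt0 ?exprn_gt0 ?ltr0n //.
  (* Since [harmonic q] is [1 / (q + 1)], the odd case amounts to [q + 1 <= 2 * q^2], which holds
     for [q >= 1]. *)
  rewrite /harmonic /= ler_pdivlMl ?ltr0n // -natr1.
  by case: (odd q) => /=; nra.
have harmonic0 := @cvg_harmonic R.
apply: (@squeeze_cvgr _ _ _ _ (fun q => 1 / 2 - harmonic q) (fun q => 1 / 2 + harmonic q)).
- by near=> q; have := dist_le q; rewrite ler_distl.
- by rewrite -[X in _ --> X]subr0; apply: cvgB => //; exact: cvg_cst.
- by rewrite -[X in _ --> X]addr0; apply: cvgD => //; exact: cvg_cst.
Unshelve. all: by end_near. Qed.
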